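(* Let $F:\mathbb{R}^d\to\mathcal{CC}(\mathbb{R}^d)$ be relaxed one-sided Lipschitz with constant $l<0$ and $L$-Lipschitz. Let $L<-2l$, and let $x_0\in\mathbb{R}^d$ and $\bar y\in\mathbb{R}^d$ be given. Then the sequence $\{x_n\}_{n\in\mathbb{N}}$ defined by \[x_{n+1}:=x_n+\frac{1}{2l}\big(\bar y-\mathrm{Proj}(\bar y,F(x_n))\big)\] converges to a solution $\bar x$ of the inclusion $\bar y\in F(x)$ and satisfies the estimates \[\mathrm{dist}(x_n,S_F(\bar y))\le\frac{L^{n-1}}{|2l|^n}\,\mathrm{dist}(\bar y,F(x_0))\] and \[|x_n-\bar x|\le-\frac{1}{2l}\,\frac{\frac{L^n}{|2l|^n}}{1-\frac{L}{|2l|}}\,\mathrm{dist}(\bar y,F(x_0))\] for $n\ge1$, where $S_F(\bar y):=\{x\in\mathbb{R}^d:\ \bar y\in F(x)\}$.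
   Context: $\mathbb{R}^d$ carries the Euclidean norm $|\cdot|$ and Euclidean inner product $\langle\cdot,\cdot\rangle$. $\mathcal{CC}(\mathbb{R}^d)$ is the family of nonempty compact convex subsets of $\mathbb{R}^d$. For sets $A,B$, $\mathrm{dist}(A,B):=\sup_{a\in A}\inf_{b\in B}|a-b|$ (for a point $y$, $\mathrm{dist}(y,B):=\inf_{b\in B}|y-b|$) and $\mathrm{dist}_H(A,B):=\max\{\mathrm{dist}(A,B),\mathrm{dist}(B,A)\}$. For $y\in\mathbb{R}^d$ and $A\in\mathcal{CC}(\mathbb{R}^d)$, $\mathrm{Proj}(y,A)$ is the unique point of $A$ with $|y-\mathrm{Proj}(y,A)|=\mathrm{dist}(y,A)$. A map $F:\mathbb{R}^d\to\mathcal{CC}(\mathbb{R}^d)$ is: $L$-Lipschitz, with $L\ge0$, if $\mathrm{dist}_H(F(x),F(x'))\le L|x-x'|$ for all $x,x'\in\mathbb{R}^d$; relaxed one-sided Lipschitz with constant $l\in\mathbb{R}$ ($l$-ROSL) if for any $x,x'\in\mathbb{R}^d$ and $y\in F(x)$ there exists $y'\in F(x')$ with $\langle y-y',x-x'\rangle\le l|x-x'|^2$. *)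

(* Defs.v *)
From HB Require Import structures.
From mathcomp Require Import all_boot all_order all_algebra.
From mathcomp Require Import all_classical all_reals all_analysis.
Import Order.TTheory GRing.Theory Num.Theory numFieldNormedType.Exports.

Set Implicit Arguments.
Unset Strict Implicit.
Unset Printing Implicit Defensive.

Local Open Scope classical_set_scope.
Local Open Scope ring_scope.

(* The space R^d is 'rV[R]_d. The norm that the library puts on it is the max
   norm, so the Euclidean structure is defined here; the library topology on
   'rV[R]_d (used for compactness and convergence) is the Euclidean one. *)

Definition edot (R : realType) (d : nat) (u v : 'rV[R]_d) : R :=
  \sum_(i < d) u 0 i * v 0 i.

Definition enorm (R : realType) (d : nat) (u : 'rV[R]_d) : R :=
  Num.sqrt (edot u u).

Definition CC (R : realType) (d : nat) (A : set 'rV[R]_d) : Prop :=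
  [/\ A !=set0, compact A & convex_set A].

(* [inf] and [sup] are real-valued and return 0 on sets without a finite
   infimum or supremum: [dist_pt] is meaningful for B nonempty, [dist] and
   [dist_H] for nonempty bounded sets. *)
Definition dist_pt (R : realType) (d : nat) (y : 'rV[R]_d) (B : set 'rV[R]_d) : R :=
  inf [set enorm (y - b) | b in B].

Definition dist (R : realType) (d : nat) (A B : set 'rV[R]_d) : R :=
  sup [set dist_pt a B | a in A].

Definition dist_H (R : realType) (d : nat) (A B : set 'rV[R]_d) : R :=
  Num.max (dist A B) (dist B A).

(* The default value [y] of [xget] is never used when A is in [CC]: the
   nearest point then exists and is unique. *)
Definition Proj (R : realType) (d : nat) (y : 'rV[R]_d) (A : set 'rV[R]_d) : 'rV[R]_d :=
  xget y [set z | A z /\ enorm (y - z) = dist_pt y A].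

Definition lipschitz_multi (R : realType) (d : nat) (L : R)
    (F : 'rV[R]_d -> set 'rV[R]_d) : Prop :=
  forall x x' : 'rV[R]_d, dist_H (F x) (F x') <= L * enorm (x - x').

Definition ROSL (R : realType) (d : nat) (l : R)
    (F : 'rV[R]_d -> set 'rV[R]_d) : Prop :=
  forall x x' y : 'rV[R]_d, F x y ->
    exists2 y' : 'rV[R]_d, F x' y' & edot (y - y') (x - x') <= l * enorm (x - x') ^+ 2.

Definition solution_set (R : realType) (d : nat)
    (F : 'rV[R]_d -> set 'rV[R]_d) (ybar : 'rV[R]_d) : set 'rV[R]_d :=
  [set x | F x ybar].

(* Main.v *)
Require Import Defs.
From HB Require Import structures.
From mathcomp Require Import all_boot all_order all_algebra.
From mathcomp Require Import all_classical all_reals all_analysis.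
From mathcomp Require Import ring lra.
Import Order.TTheory GRing.Theory Num.Theory numFieldNormedType.Exports.

Local Open Scope classical_set_scope.
Local Open Scope ring_scope.

(** Write [c = 1 / (2 * l)], [q = L / `|2 * l|] and let [r n] be the residual
    [dist_pt ybar (F (x n))], so that one step has length [`|c| * r n].

    Convergence rests on [residual_contraction]: one step multiplies the residual
    by at most [q].  For a single-valued [F] this is an expansion of squares, but
    here the one-sided Lipschitz condition and the Lipschitz condition provide
    different points of [F (x n.+1)].  The remedy is to test [F (x n.+1)] only
    along the direction [w] from its nearest point to [ybar], and to reach
    [x n.+1] through an intermediate point [x''] with two properties: [x'' - x n]
    is parallel to [w], so that the one-sided condition speaks about [w], and
    [x''] is exactly as far from [x n.+1] as [x n] is, since [x'' - x n.+1] is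
    the reflection of [x n.+1 - x n] in the line spanned by [w].  Hence [r n <= q ^+ n * r 0],
    the iterates are Cauchy, the limit is a solution, and summing the geometric
    tail gives the second estimate.

    The first estimate is sharper than that sum allows.  It holds because
    there are solutions in, or arbitrarily close to, the ball centred at [x n.+1]
    whose radius is the step length ([dist_solution_set]).  This ball is the set of [z] with
    [edot (ybar - y) (z - x n) <= l * enorm (z - x n) ^+ 2], where [y] is the
    projection of [ybar] on [F (x n)]; so one needs a solution that is in
    one-sided relation with the given pair [(x n, y)].  Iteration does not
    give it, because a chain of selections loses the relation with its first
    point.  Instead, for small [tau], the map
    [z |-> Proj (y - tau^-1 *: (z - x n)) (F z)] is a continuous selection of [F]
    ([Proj_continuous]) which satisfies the relation up to [O(tau)]
    ([far_selection]), because projecting a far away point nearly minimises the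
    linear functional [edot _ (z - x n)] over [F z].  Minus [ybar],
    this selection points inward on large spheres, so it takes the
    value [ybar] by a theorem of Brouwer type ([zero_of_acute]), and the point
    found solves the inclusion exactly and lies within [O(tau)] of the ball
    ([localized_solution]).

    The Brouwer type theorem comes from a cubical Sperner lemma ([kuhn_cell]).
    Its labels form one 0-cochain over F_2 per coordinate; the cup product of
    their coboundaries is a coboundary, so its sum over the whole grid is a
    boundary term, and the boundary conditions make that term 1, dimension by
    dimension.  Some cell contributes, and in it every label changes. *)

Set Implicit Arguments.
Unset Strict Implicit.
Unset Printing Implicit Defensive.

(** * A Sperner lemma on cubical grids *)

Section Labels.
Context {I : finType}.
Implicit Types (v w : I -> nat) (i j k : I) (s : seq I) (J : {set I}).

Definition upd v i t : I -> nat := fun k => if k == i then t else v k.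

Definition step v i := upd v i (v i).+1.

Lemma upd_same v i t : upd v i t i = t.
Proof. by rewrite /upd eqxx. Qed.

Lemma upd_other v i t k : k != i -> upd v i t k = v k.
Proof. by rewrite /upd => /negbTE ->. Qed.

Lemma updC v i j t u : i != j -> upd (upd v i t) j u = upd (upd v j u) i t.
Proof.
move=> ij; apply/funext => k; rewrite /upd.
by case: (eqVneq k j) => [->|//]; rewrite eq_sym (negbTE ij).
Qed.

Lemma upd_upd v i t u : upd (upd v i t) i u = upd v i u.
Proof. by apply/funext => k; rewrite /upd; case: eqP. Qed.

Lemma stepC v i j : step (step v i) j = step (step v j) i.
Proof.
have [->//|ij] := eqVneq i j; rewrite /step updC //.
by rewrite !upd_other // eq_sym.
Qed.

Lemma addF2 (x : 'F_2) : x + x = 0.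
Proof. by apply: addrr_pchar2; exact: pchar_Fp. Qed.

Lemma sum_pairsC (g : I -> I -> 'F_2) J :
  \sum_(j in J) \sum_(k in J :\ j) g j k = \sum_(j in J) \sum_(k in J :\ j) g k j.
Proof.
rewrite (exchange_big_dep (mem J)) /=; last by move=> j k _; rewrite !inE => /andP[].
apply: eq_bigr => j jJ; apply: eq_bigl => k.
by rewrite !inE jJ eq_sym andbT andbC.
Qed.

Lemma sum_pairs_sym (g : I -> I -> 'F_2) J :
  (forall j k, g j k = g k j) -> \sum_(j in J) \sum_(k in J :\ j) g j k = 0.
Proof.
move=> gC.
pose lt (j k : I) := (enum_rank j < enum_rank k)%N.
pose h j k := if lt j k then g j k else 0.
have -> : \sum_(j in J) \sum_(k in J :\ j) g j k =
    \sum_(j in J) \sum_(k in J :\ j) (h j k + h k j).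
  apply: eq_bigr => j _; apply: eq_bigr => k; rewrite !inE => /andP[kj _].
  rewrite /h /lt; case: ltngtP => [_|_|/val_inj/enum_rank_inj jk].
  - by rewrite addr0.
  - by rewrite add0r gC.
  - by rewrite jk eqxx in kj.
under eq_bigr do rewrite big_split /=.
by rewrite big_split /= (sum_pairsC h) addF2.
Qed.

Variable lam : I -> (I -> nat) -> 'F_2.

(** For [s = [:: i1; ...; im]] and [J] with [m] elements, [cup s J v] sums, over
    the monotone edge paths from [v] to the opposite corner of the cell at [v]
    spanned by the directions [J], the products of the increments of
    [lam i1], ..., [lam im] along the successive edges.  It is the value on that
    cell of the cup product of the coboundaries of the labels. *)
Fixpoint cup s J v : 'F_2 :=
  if s is i :: s' then
    \sum_(j in J) (lam i (step v j) + lam i v) * cup s' (J :\ j) (step v j)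
  else 1.

Lemma setD1C J j k : J :\ j :\ k = J :\ k :\ j.
Proof. by apply/setP => i; rewrite !inE andbCA. Qed.

(** A cup product of coboundaries is a cocycle: the faces of a cell, top ones
    (shifted by one step) and bottom ones, contribute 0 in total.  In the
    induction, two-step terms are symmetric in the order of the steps and cancel
    modulo 2; the others regroup into instances for smaller cells. *)
Lemma cup_closed s J v :
  \sum_(j in J) cup s (J :\ j) (step v j) = \sum_(j in J) cup s (J :\ j) v.
Proof.
elim: s J v => [|i s IH] J v //=.
pose c j k w := cup s (J :\ j :\ k) w.
have cC j k w : c j k w = c k j w by rewrite /c setD1C.
have cstep j w : \sum_(k in J :\ j) c j k (step w k) = \sum_(k in J :\ j) c j k w.
  exact: IH.
have -> : \sum_(j in J) \sum_(k in J :\ j)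
    (lam i (step (step v j) k) + lam i (step v j)) * c j k (step (step v j) k) =
    \sum_(j in J) lam i (step v j) * \sum_(k in J :\ j) c j k (step v j).
  under eq_bigr do under eq_bigr do rewrite mulrDl.
  under eq_bigr do rewrite big_split /=.
  rewrite big_split /= sum_pairs_sym ?add0r; last first.
    by move=> j k; rewrite stepC cC.
  by apply: eq_bigr => j _; rewrite -mulr_sumr cstep.
have -> : \sum_(j in J) \sum_(k in J :\ j)
    (lam i (step v k) + lam i v) * c j k (step v k) =
    \sum_(j in J) \sum_(k in J :\ j) lam i (step v k) * c j k (step v k).
  under eq_bigr do under eq_bigr do rewrite mulrDl.
  under eq_bigr do rewrite big_split /=.
  rewrite big_split /= [X in _ + X](_ : _ = 0) ?addr0 //.
  under eq_bigr do rewrite -mulr_sumr cstep.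
  by rewrite -mulr_sumr sum_pairs_sym ?mulr0.
rewrite sum_pairsC; apply: eq_bigr => j _; rewrite mulr_sumr.
by apply: eq_bigr => k _; rewrite cC.
Qed.

(** The Leibniz rule in integrated form: the cup product of [s] with the
    coboundary of [lam i] is the coboundary of [lam i * cup s], since [cup s] is
    closed.  This is what makes sums over a grid collapse to its boundary. *)
Lemma cup_telescope i s J v :
  cup (i :: s) J v = \sum_(j in J)
    (lam i (step v j) * cup s (J :\ j) (step v j) + lam i v * cup s (J :\ j) v).
Proof.
rewrite /=; under eq_bigr do rewrite mulrDl.
by rewrite !big_split /= -!mulr_sumr cup_closed.
Qed.

(** No path inside a face transverse to [j] sees a label that is constant on
    this face change. *)
Lemma cup_face i s J v j (b : 'F_2) : i \in s -> j \notin J ->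
  (forall w, w j = v j -> lam i w = b) -> cup s J v = 0.
Proof.
elim: s J v => [//|k s IH] J v; rewrite inE => /orP[/eqP <-|is_] jJ lamb /=.
  apply: big1 => l lJ; have jl : j != l by apply: contraNneq jJ => ->.
  by rewrite !lamb ?addF2 ?mul0r // /step upd_other.
apply: big1 => l lJ; have jl : j != l by apply: contraNneq jJ => ->.
rewrite (IH (J :\ l)) ?mulr0 // ?inE ?(negbTE jJ) ?andbF //.
by move=> w wj; apply: lamb; rewrite wj /step upd_other.
Qed.

Definition in_cell v w := forall k, (v k <= w k <= (v k).+1)%N.

Lemma cup_neq0 s J v i : cup s J v != 0 -> i \in s ->
  exists p q, [/\ forall k, (v k <= p k <= v k + (k \in J))%N,
                  forall k, (v k <= q k <= v k + (k \in J))%N &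
                  lam i p != lam i q].
Proof.
have cell A w l : l \in A -> forall k, (w k <= step w l k <= w k + (k \in A))%N.
  move=> lA k; rewrite /step /upd; case: eqP => [->|_].
    by rewrite lA addn1 leqnn leqnSn.
  by rewrite leqnn leq_addr.
elim: s J v => [//|k s IH] J v /= /eqP nz.
have /existsP[j /andP[jJ]] : [exists j, (j \in J) &&
   ((lam k (step v j) + lam k v) * cup s (J :\ j) (step v j) != 0)].
  apply/existsP; apply: contra_notP nz => /forallNP H.
  apply: big1 => j jJ; apply/eqP; have /negP := H j.
  by rewrite jJ negbK.
rewrite mulf_eq0 negb_or => /andP[lnz cnz]; rewrite inE => /orP[/eqP ->|is_].
  exists (step v j), v; split => [l|l|].
  - exact: cell.
  - by rewrite leqnn leq_addr.
  - by apply: contra lnz => /eqP ->; rewrite addF2.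
have [p [q [pc qc pq]]] := IH _ _ cnz is_.
have sub r : (forall l, (step v j l <= r l <= step v j l + (l \in J :\ j))%N) ->
    forall l, (v l <= r l <= v l + (l \in J))%N.
  move=> rc l; move: (rc l); rewrite !inE /step /upd; case: eqP => [->|_] //=.
  by rewrite addn0 jJ addn1 => /andP[a ->]; rewrite ltnW.
by exists p, q; split => //; exact: sub.
Qed.

Variable N : nat.

Fixpoint bsum s (f : (I -> nat) -> 'F_2) v : 'F_2 :=
  if s is i :: s' then \sum_(t < N) bsum s' f (upd v i t) else f v.

Lemma eq_bsum s f g v : f =1 g -> bsum s f v = bsum s g v.
Proof. by move=> /funext ->. Qed.

Lemma bsum_sum s (T : finType) (P : pred T) (f : T -> (I -> nat) -> 'F_2) v :
  bsum s (fun w => \sum_(t | P t) f t w) v = \sum_(t | P t) bsum s (f t) v.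
Proof.
elim: s v => [//|i s IH] v /=; rewrite exchange_big /=.
by apply: eq_bigr => t _; rewrite IH.
Qed.

Lemma bsum_upd s f v i t : i \notin s ->
  bsum s f (upd v i t) = bsum s (fun w => f (upd w i t)) v.
Proof.
elim: s v => [//|j s IH] v; rewrite inE negb_or => /andP[ij is_] /=.
by apply: eq_bigr => u _; rewrite updC // IH.
Qed.

Lemma bsum_eq0 s f v : (forall w, f w = 0) -> bsum s f v = 0.
Proof.
move=> f0; elim: s v => [//|i s IH] v /=; by apply: big1.
Qed.

Lemma bsum_telescope s j (K : (I -> nat) -> 'F_2) v : uniq s -> j \in s ->
  bsum s (fun w => K (step w j) + K w) v =
  bsum (rem j s) (fun w => K (upd w j N) + K (upd w j 0%N)) v.
Proof.
elim: s v => [//|i s IH] v /= /andP[is_ us]; rewrite inE.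
case: (eqVneq j i) => [-> _|ij /= js].
  under eq_bigr do rewrite bsum_upd //.
  rewrite -(bsum_sum s xpredT (fun (t : 'I_N) w => K (step (upd w i t) i) + K (upd w i t))).
  apply: eq_bsum => w; under eq_bigr do rewrite /step upd_same upd_upd.
  elim: N => [|n IHn]; first by rewrite big_ord0 addF2.
  rewrite big_ord_recr /= IHn.
  by rewrite addrC -addrA [X in _ + X]addrA addF2 add0r.
by apply: eq_bigr => t _; exact: IH.
Qed.

Lemma bsum_neq0 s f v : uniq s -> bsum s f v != 0 ->
  exists w, [/\ forall i, i \in s -> (w i < N)%N, forall i, i \notin s -> w i = v i & f w != 0].
Proof.
elim: s v => [|i s IH] v /=; first by move=> _ nz; exists v.
move=> /andP[is_ us] /eqP nz.
have /existsP[t tnz] : [exists t : 'I_N, bsum s f (upd v i t) != 0].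
  apply/existsP; apply: contra_notP nz => /forallNP H.
  by apply: big1 => t _; apply/eqP; have /negP := H t; rewrite negbK.
have [w [w1 w2 fw]] := IH _ us tnz.
exists w; split => // j; rewrite inE.
  by have [->|_] := eqVneq j i; [rewrite w2 // upd_same|exact: w1].
by rewrite negb_or => /andP[ji js]; rewrite w2 // upd_other.
Qed.

Hypothesis lam0 : forall i w, w i = 0%N -> lam i w = 0.
Hypothesis lamN : forall i w, w i = N -> lam i w = 1.

(** Summing [cup_telescope] over the grid leaves the two faces transverse to each
    direction.  If [j] lies in the tail [s], then [lam j] is constant on both of its
    faces and both vanish; for the head [i] the lower face carries the factor 0
    and the upper one the factor 1, which leaves the same sum in one dimension less. *)
Lemma bsum_cup s v : uniq s -> bsum s (cup s [set j in s]) v = 1.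
Proof.
elim: s v => [//|i s IH] v us; have /andP[is_ us'] := us.
pose J := [set j in i :: s].
pose K j w := lam i w * cup s (J :\ j) w.
rewrite (eq_bsum _ _ (fun w => cup_telescope i s J w)).
rewrite (bsum_sum _ (mem J) (fun j w => K j (step w j) + K j w)).
rewrite (bigD1 i) ?inE ?eqxx // (bsum_telescope (K i)) ?inE ?eqxx // [rem _ _]/= eqxx.
rewrite big1 => [|j /andP[]]; last first.
  rewrite !inE => /orP[->//|js ji].
  rewrite (bsum_telescope (K j)) // ?inE ?js ?orbT //.
  apply: bsum_eq0 => w; rewrite /K.
  rewrite (@cup_face j _ _ _ j 1) ?js ?inE ?eqxx //; last first.
    by move=> u; rewrite upd_same => /lamN.
  rewrite (@cup_face j _ _ _ j 0) ?js ?inE ?eqxx ?mulr0 ?addr0 //.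
  by move=> u; rewrite upd_same => /lam0.
rewrite [LHS]addr0.
have Ji : J :\ i = [set j in s].
  apply/setP => j; rewrite !inE; have [->|//] := eqVneq j i.
  by rewrite (negbTE is_).
rewrite -[RHS](IH (upd v i N) us') bsum_upd //.
apply: eq_bsum => w.
by rewrite /K Ji lamN ?upd_same // lam0 ?upd_same // mul1r mul0r addr0.
Qed.

(** A cubical Sperner lemma: no continuity is involved, only the boundary values
    of the labels. *)
Lemma kuhn_cell : exists v,
  (forall i, (v i < N)%N) /\
  forall i, exists p q, [/\ in_cell v p, in_cell v q, lam i p = 0 & lam i q = 1].
Proof.
have nz : bsum (enum I) (cup (enum I) [set j in enum I]) (fun=> 0%N) != 0.
  by rewrite bsum_cup ?enum_uniq ?oner_eq0.
have [v [vN _ cnz]] := bsum_neq0 (enum_uniq I) nz.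
exists v; split=> [i|i]; first by rewrite vN // mem_enum.
have [|p [q [pc qc pq]]] := cup_neq0 cnz (_ : i \in enum I); first by rewrite mem_enum.
have cell r : (forall l, (v l <= r l <= v l + (l \in [set j in enum I]))%N) -> in_cell v r.
  by move=> rc l; have := rc l; rewrite inE mem_enum addn1.
have F2 (x : 'F_2) : (x == 0) || (x == 1) by case: x => -[|[|//]] ?.
move: pq (F2 (lam i p)) (F2 (lam i q)) => pq /orP[]/eqP pl /orP[]/eqP ql.
- by rewrite pl ql eqxx in pq.
- by exists p, q; split => //; exact: cell.
- by exists q, p; split => //; exact: cell.
- by rewrite pl ql eqxx in pq.
Qed.

End Labels.

(** * Zeros of continuous fields that point inward *)

Section Cube.
Context {R : realType} {d : nat}.
Implicit Types (x y : 'rV[R]_d) (r : R) (i : 'I_d).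

Definition grid_pt r n (w : 'I_d -> nat) : 'rV[R]_d :=
  \row_i (- r + 2 * r * (w i)%:R / n.+1%:R).

Lemma grid_pt_first r n w i : w i = 0%N -> grid_pt r n w 0 i = - r.
Proof. by move=> wi; rewrite mxE wi mulr0 mul0r addr0. Qed.

Lemma grid_pt_last r n w i : w i = n.+1 -> grid_pt r n w 0 i = r.
Proof. by move=> wi; rewrite mxE wi mulfK ?pnatr_eq0 //; ring. Qed.

Lemma grid_pt_cell r n v w i : 0 <= r -> in_cell v w ->
  `|grid_pt r n v 0 i - grid_pt r n w 0 i| <= 2 * r / n.+1%:R.
Proof.
move=> r0 /(_ i) /andP[vw wv]; rewrite !mxE.
have -> : - r + 2 * r * (v i)%:R / n.+1%:R - (- r + 2 * r * (w i)%:R / n.+1%:R) =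
   - (2 * r / n.+1%:R * ((w i)%:R - (v i)%:R)) by ring.
have h0 : 0 <= 2 * r / n.+1%:R by rewrite divr_ge0 // mulr_ge0.
rewrite normrN normrM (ger0_norm h0) ler_piMr // ger0_norm.
  by rewrite lerBlDr addrC natr1 ler_nat.
by rewrite subr_ge0 ler_nat.
Qed.

Lemma grid_pt_cube r n w : 0 <= r -> (forall i, (w i <= n.+1)%N) ->
  forall i, `[- r, r]%classic (grid_pt r n w 0 i).
Proof.
move=> r0 wn i; rewrite mxE /= in_itv /=.
have n0 : (0 : R) < n.+1%:R by rewrite ltr0n.
have t0 : 0 <= (w i)%:R / n.+1%:R :> R by rewrite divr_ge0.
have t1 : (w i)%:R / n.+1%:R <= 1 :> R by rewrite ler_pdivrMr // mul1r ler_nat.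
move: t0 t1; rewrite -mulrA; move: (_ / _) => t t0 t1.
by apply/andP; split; nra.
Qed.

(** The variational inequality for [- g] on a cube, in coordinates: each coordinate
    of [g x] is 0, or [x] lies on the face that this coordinate points to.
    Label a grid point in coordinate [i] by whether [g] has there a nonpositive
    [i]-th coordinate, with prescribed labels on the faces, and let the mesh of
    the grid tend to 0. *)
Lemma cube_variational (g : 'rV[R]_d -> 'rV[R]_d) r : 0 < r -> continuous g ->
  exists x, forall i, (x 0 i = - r \/ 0 <= g x 0 i) /\ (x 0 i = r \/ g x 0 i <= 0).
Proof.
move=> r0 cg; have r0' := ltW r0.
pose lam n i w : 'F_2 := ((w i != 0%N) &&
  ((w i == n.+1) || (g (grid_pt r n w) 0 i <= 0)))%:R.
have cells n : exists v : 'I_d -> nat, (forall i, (v i < n.+1)%N) /\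
    forall i, exists p q, [/\ in_cell v p, in_cell v q, lam n i p = 0 & lam n i q = 1].
  by apply: kuhn_cell => i w wi; rewrite /lam wi ?eqxx.
have {cells} [v vP] := choice cells.
pose A := [set x : 'rV[R]_d | forall i, `[- r, r]%classic (x 0 i)].
have cA : compact A.
  by apply: (@rV_compact _ _ (fun=> `[- r, r]%classic)) => i; exact: segment_compact.
have [|x [Ax xc]] := cA ((fun n => grid_pt r n (v n)) @ \oo).
  by exists 0%N => // n _ /=; apply: grid_pt_cube => // i; rewrite ltnW //; case: (vP n).
(* Around the cluster point [x], some cell with all label changes lies
   entirely in any given neighbourhood. *)
have nearU U : nbhs x U -> exists n, forall w, in_cell (v n) w -> U (grid_pt r n w).
  rewrite -nbhs_ballE => -[e /= e0 eU].
  have [m mP] : exists m : nat, forall n, (m <= n)%N -> 2 * r / n.+1%:R < e / 2.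
    exists (Num.truncn (4 * r / e)).+1 => n mn.
    have : 4 * r / e < n.+1%:R.
      apply: lt_le_trans (_ : (Num.truncn (4 * r / e)).+1%:R <= _); first exact: truncnS_gt.
      by rewrite ler_nat ltnW.
    rewrite ltr_pdivrMr // ltr_pdivrMr ?ltr0n //; nra.
  have e2 : 0 < e / 2 by rewrite divr_gt0.
  have [|y [[n /= mn <-] xy]] := xc ((fun n => grid_pt r n (v n)) @` [set n | (m <= n)%N])
      (ball x (e / 2)) _ (nbhsx_ballx x (e / 2) e2).
    by exists m => // n /= mn; exists n.
  exists n => w cw; apply: eU; split=> // a i.
  have := xy.2 a i; rewrite !ord1 /ball /=.
  have := grid_pt_cell n i r0' cw; have := mP n mn.
  move=> h1 h2 h3; rewrite -(subrKA (grid_pt r n (v n) 0 i)).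
  apply: le_lt_trans (ler_normD _ _) _; rewrite [e]splitr ltrD //.
  exact: le_lt_trans h2 h1.
have cx i : {for x, continuous (fun y => y 0 i)} by exact: coord_continuous.
have cgx i : {for x, continuous (fun y => g y 0 i)}.
  apply: (@continuous_comp _ _ _ g (fun z : 'rV[R]_d => z 0 i)); first exact: cg.
  exact: coord_continuous.
exists x => i; have := Ax i; rewrite /= in_itv /= => /andP[xr1 xr2]; split.
- have [|xr] := eqVneq (x 0 i) (- r); [by left|right].
  have {xr xr1} xr : - r < x 0 i by rewrite lt_neqAle eq_sym xr.
  rewrite leNgt; apply/negP => gx.
  have [|n nP] := nearU [set y : 'rV[R]_d | - r < y 0 i /\ g y 0 i < 0].
    by apply: filterI; [exact: (cvgr_gt _ (cx i))|exact: (cvgr_lt _ (cgx i))].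
  have [_ /(_ i)[p [q [cp _ lp _]]]] := vP n; have [h1 h2] := nP _ cp.
  have [p0|p0] := eqVneq (p i) 0%N; first by rewrite grid_pt_first ?ltxx in h1.
  by move: lp; rewrite /lam p0 (ltW h2) orbT => /eqP; rewrite oner_eq0.
- have [|xr] := eqVneq (x 0 i) r; [by left|right].
  have {xr xr2} xr : x 0 i < r by rewrite lt_neqAle xr.
  rewrite leNgt; apply/negP => gx.
  have [|n nP] := nearU [set y : 'rV[R]_d | y 0 i < r /\ 0 < g y 0 i].
    by apply: filterI; [exact: (cvgr_lt _ (cx i))|exact: (cvgr_gt _ (cgx i))].
  have [_ /(_ i)[p [q [_ cq _ lq]]]] := vP n; have [h1 h2] := nP _ cq.
  have [qn|qn] := eqVneq (q i) n.+1; first by rewrite grid_pt_last ?ltxx in h1.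
  move: lq; rewrite /lam (negbTE qn) leNgt h2 andbF => /eqP.
  by rewrite eq_sym oner_eq0.
Qed.

(** At the point given by [cube_variational], [g x] has the sign of [x] in every
    coordinate, so [edot (g x) x >= 0]; if moreover [g x] is not 0 then [x] is on
    the boundary of the cube, where the hypothesis says the opposite. *)
Lemma zero_of_acute (g : 'rV[R]_d -> 'rV[R]_d) r : 0 < r -> continuous g ->
  (forall x, r <= enorm x -> edot (g x) x < 0) -> exists x, g x = 0.
Proof.
move=> r0 cg acute; have [x xP] := cube_variational r0 cg; exists x.
have pos i : 0 <= g x 0 i * x 0 i.
  have [] := xP i; have [] := ltgtP (g x 0 i) 0.
  - by move=> g0 [->|]; [nra|lra].
  - by move=> g0 _ [->|]; [nra|lra].
  - by move=> -> _ _; rewrite mul0r.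
apply/rowP => i; rewrite mxE; apply/eqP; apply: contraT => gi.
have /acute : r <= enorm x.
  have xi : r ^+ 2 = x 0 i ^+ 2.
    have [] := xP i; have [] := ltgtP (g x 0 i) 0.
    - by move=> g0 [->|]; [rewrite sqrrN|lra].
    - by move=> g0 _ [->|]; [|lra].
    - by move=> g0; rewrite g0 eqxx in gi.
  rewrite -(ger0_norm (ltW r0)) -sqrtr_sqr ler_sqrt ?sumr_ge0 // => [|j _].
    rewrite xi expr2 /edot (bigD1 i) //= lerDl sumr_ge0 // => j _.
    by rewrite -expr2 sqr_ge0.
  by rewrite -expr2 sqr_ge0.
by rewrite ltNge sumr_ge0.
Qed.

End Cube.

(** * The Euclidean structure *)

Section Euclid.
Context {R : realType} {d : nat}.
Implicit Types (u v w x y z b : 'rV[R]_d) (A : set 'rV[R]_d) (a : R).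

Lemma edotC u v : edot u v = edot v u.
Proof. by apply: eq_bigr => i _; rewrite mulrC. Qed.

Lemma edotDl u v w : edot (u + v) w = edot u w + edot v w.
Proof. by rewrite -big_split; apply: eq_bigr => i _; rewrite mxE mulrDl. Qed.

Lemma edotZl a u v : edot (a *: u) v = a * edot u v.
Proof. by rewrite mulr_sumr; apply: eq_bigr => i _; rewrite mxE mulrA. Qed.

Lemma edotNl u v : edot (- u) v = - edot u v.
Proof. by rewrite -scaleN1r edotZl mulN1r. Qed.

Lemma edotDr u v w : edot u (v + w) = edot u v + edot u w.
Proof. by rewrite edotC edotDl ![edot _ u]edotC. Qed.

Lemma edotZr a u v : edot u (a *: v) = a * edot u v.
Proof. by rewrite edotC edotZl edotC. Qed.

Lemma edotNr u v : edot u (- v) = - edot u v.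
Proof. by rewrite edotC edotNl edotC. Qed.

Definition edotE := (edotDl, edotDr, edotNl, edotNr, edotZl, edotZr).

Lemma edot_ge0 u : 0 <= edot u u.
Proof. by apply: sumr_ge0 => i _; rewrite -expr2 sqr_ge0. Qed.

Lemma enorm_ge0 u : 0 <= enorm u. Proof. exact: sqrtr_ge0. Qed.

Lemma enorm_sqr u : enorm u ^+ 2 = edot u u.
Proof. by rewrite sqr_sqrtr ?edot_ge0. Qed.

Lemma enormN u : enorm (- u) = enorm u.
Proof. by rewrite /enorm edotNl edotNr opprK. Qed.

Lemma enormBC u v : enorm (u - v) = enorm (v - u).
Proof. by rewrite -enormN opprB. Qed.

Lemma enormZ a u : enorm (a *: u) = `|a| * enorm u.
Proof. by rewrite /enorm edotZl edotZr mulrA sqrtrM -?expr2 ?sqr_ge0 // sqrtr_sqr. Qed.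

Lemma enorm_eq0 u : enorm u = 0 -> u = 0.
Proof.
move=> u0; have /eqP := enorm_sqr u; rewrite u0 expr0n /= eq_sym.
rewrite psumr_eq0 => [/allP H|i _]; last by rewrite -expr2 sqr_ge0.
apply/rowP => i; have := H i (mem_index_enum _).
by rewrite mxE -expr2 sqrf_eq0 => /eqP.
Qed.

Lemma edot_le u v : edot u v <= enorm u * enorm v.
Proof.
have [->|v0] := eqVneq v 0.
  by rewrite -(scale0r 0) edotZr mul0r mulr_ge0 ?enorm_ge0.
have nv : 0 < enorm v.
  by rewrite lt_neqAle enorm_ge0 andbT eq_sym; apply: contra_neq v0; exact: enorm_eq0.
have := edot_ge0 (enorm v *: u - enorm u *: v).
rewrite !edotE -!enorm_sqr (edotC v) => H.
have [u0|u0] := eqVneq (enorm u) 0.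
  by rewrite (enorm_eq0 u0) -(scale0r 0) edotZl mul0r mulr_ge0 ?enorm_ge0.
have nu : 0 < enorm u by rewrite lt_neqAle enorm_ge0 andbT eq_sym.
have nuv := mulr_gt0 nu nv.
rewrite -(ler_pM2l nuv); lra.
Qed.

Lemma edot_ge u v : - (enorm u * enorm v) <= edot u v.
Proof. by rewrite lerNl -edotNl -(enormN u); exact: edot_le. Qed.

Lemma ler_enorm u v : (enorm u <= enorm v) = (edot u u <= edot v v).
Proof. by rewrite ler_sqrt ?edot_ge0. Qed.

Lemma enormD u v : enorm (u + v) <= enorm u + enorm v.
Proof.
rewrite -(@ler_pXn2r _ 2%N) ?nnegrE ?addr_ge0 ?enorm_ge0 //.
rewrite enorm_sqr !edotE sqrrD !enorm_sqr (edotC v).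
have := edot_le u v; lra.
Qed.

Lemma enorm_triangle v u w : enorm (u - w) <= enorm (u - v) + enorm (v - w).
Proof. by rewrite -(subrKA v); exact: enormD. Qed.

Lemma mx_norm_le_enorm u : `|u| <= enorm u.
Proof.
rewrite [leLHS]/Num.norm /= mx_normrE; apply: bigmax_le => [|[i j] _ /=].
  exact: enorm_ge0.
rewrite -sqrtr_sqr ler_sqrt ?edot_ge0 // /edot (bigD1 j) //= ord1 -expr2.
by rewrite lerDl sumr_ge0 // => k _; rewrite -expr2 sqr_ge0.
Qed.

Lemma enorm_le_mx_norm u : enorm u <= d.+1%:R * `|u|.
Proof.
have h0 : 0 <= d.+1%:R * `|u| by rewrite mulr_ge0.
rewrite -(ger0_norm h0) -sqrtr_sqr ler_sqrt ?sqr_ge0 //.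
have ui i : u 0 i * u 0 i <= `|u| ^+ 2.
  rewrite -expr2 -[leLHS](real_normK (num_real _)) ler_pXn2r ?nnegrE //.
  rewrite [leRHS]/Num.norm /= mx_normrE.
  by apply: (@le_bigmax _ _ _ 0 (fun ij : 'I_1 * 'I_d => `|u ij.1 ij.2|) (0, i)).
apply: le_trans (ler_sum _ (fun i _ => ui i)) _.
rewrite sumr_const card_ord exprMn -[leLHS]mulr_natl ler_wpM2r ?sqr_ge0 //.
by rewrite -natrX ler_nat (leq_trans (leqnSn d)) // expnS expn1 leq_pmulr.
Qed.

(** The topology on row vectors is that of the max norm, which is equivalent to
    [enorm]. *)
Lemma continuous_of_enorm (f : 'rV[R]_d -> 'rV[R]_d) :
  (forall x e, 0 < e -> exists2 dl, 0 < dl &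
     forall y, enorm (x - y) < dl -> enorm (f x - f y) < e) -> continuous f.
Proof.
move=> fP x; apply/(@cvgrPdist_lt _ _ _ (nbhs x) (nbhs_filter x)) => e e0.
have [dl dl0 dlP] := fP x e e0.
have d0 : (0 : R) < d.+1%:R by rewrite ltr0n.
apply/nbhs_ballP; exists (dl / d.+1%:R) => /=; first exact: divr_gt0.
move=> y; rewrite -ball_normE /= ltr_pdivlMr // mulrC => xy.
apply: le_lt_trans (mx_norm_le_enorm _) _; apply: dlP.
exact: le_lt_trans (enorm_le_mx_norm _) xy.
Qed.

Lemma enorm_dist_continuous y : continuous (fun b => enorm (y - b)).
Proof.
move=> b; apply/(@cvgrPdist_lt _ _ _ (nbhs b) (nbhs_filter b)) => e e0.
have d0 : (0 : R) < d.+1%:R by rewrite ltr0n.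
apply/nbhs_ballP; exists (e / d.+1%:R) => /=; first exact: divr_gt0.
move=> c; rewrite -ball_normE /= ltr_pdivlMr // mulrC => bc.
apply: le_lt_trans (le_lt_trans (enorm_le_mx_norm (b - c)) bc).
rewrite ler_norml; have := enorm_triangle c y b; have := enorm_triangle b y c.
rewrite (enormBC c b); lra.
Qed.

(** * Nearest points in compact convex sets *)

Lemma dist_pt_le y A b : A b -> dist_pt y A <= enorm (y - b).
Proof.
move=> Ab; apply: ge_inf; last by exists b.
by exists 0 => _ [c _ <-]; exact: enorm_ge0.
Qed.

Lemma dist_pt_ge0 y A : 0 <= dist_pt y A.
Proof.
have [->|/set0P[b Ab]] := eqVneq A set0.
  by rewrite /dist_pt image_set0 inf0.
apply: lb_le_inf; first by exists (enorm (y - b)), b.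
by move=> _ [c _ <-]; exact: enorm_ge0.
Qed.

Lemma Proj_nearest y A : CC A -> A (Proj y A) /\ enorm (y - Proj y A) = dist_pt y A.
Proof.
move=> [A0 cA _].
apply: (@xgetPex _ y [set z | A z /\ enorm (y - z) = dist_pt y A]).
have [|c cA' cmin] := @EVT_min_rV R d (fun b => enorm (y - b)) A A0 cA.
  by apply: continuous_subspaceT; exact: enorm_dist_continuous.
move: cA'; rewrite inE => Ac; exists c; split=> //.
apply/eqP; rewrite eq_le dist_pt_le // andbT; apply: lb_le_inf.
  by exists (enorm (y - c)), c.
by move=> _ [b Ab <-]; apply: cmin; rewrite inE.
Qed.

Lemma convex_setP A : convex_set A -> forall b c t, A b -> A c -> 0 <= t -> t <= 1 ->
  A (b + t *: (c - b)).
Proof.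
move=> cvA b c t Ab Ac t0 t1.
have -> : b + t *: (c - b) = t *: c + (1 - t) *: b.
  by rewrite scalerBl scale1r scalerBr addrCA.
by rewrite -in_setE; apply: (cvA c b (Itv01 t0 t1)); rewrite in_setE.
Qed.

(** Comparing [Proj y A] with the points of the segment from [Proj y A] to [b], at
    the parameter that minimises the distance to [y]. *)
Lemma Proj_variational y A b : CC A -> A b ->
  edot (y - Proj y A) (b - Proj y A) <= 0.
Proof.
move=> AC Ab; have [Ap pE] := Proj_nearest y AC; have [_ _ cvA] := AC.
set p := Proj y A in Ap pE *; rewrite leNgt; apply/negP => c0.
have min t : 0 <= t -> t <= 1 ->
    2 * t * edot (y - p) (b - p) <= t ^+ 2 * edot (b - p) (b - p).
  move=> t0 t1; have := dist_pt_le y (convex_setP cvA Ap Ab t0 t1).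
  rewrite -pE ler_enorm opprD addrA; move: (y - p) (b - p) => u v.
  rewrite !edotE (edotC v u); lra.
move: c0 min; set c := edot _ _; set E := edot _ _ => c0 min.
have h1 : 2 * c <= E by have := min 1; rewrite !mulr1 expr1n mul1r; exact.
have E0 : 0 < E by lra.
have t0 : 0 <= c / E by rewrite divr_ge0 // ltW.
have t1 : c / E <= 1 by rewrite ler_pdivrMr // mul1r; lra.
have := min _ t0 t1.
have -> : 2 * (c / E) * c = 2 * (c ^+ 2 / E) by field; rewrite gt_eqF.
have -> : (c / E) ^+ 2 * E = c ^+ 2 / E by field; rewrite gt_eqF.
have : 0 < c ^+ 2 / E by rewrite divr_gt0 // exprn_gt0.
lra.
Qed.

Lemma compact_enorm_bounded A y : compact A ->
  exists2 M, 0 <= M & forall b, A b -> enorm (y - b) <= M.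
Proof.
move=> cA; have [->|/set0P A0] := eqVneq A set0; first by exists 0.
have [|c _ cmax] := @EVT_max_rV R d (fun b => enorm (y - b)) A A0 cA.
  by apply: continuous_subspaceT; exact: enorm_dist_continuous.
exists (enorm (y - c)); first exact: enorm_ge0.
by move=> b Ab; apply: cmax; rewrite inE.
Qed.

Lemma lipschitz_pointwise L (F : 'rV[R]_d -> set 'rV[R]_d) x x' b :
  (forall z, CC (F z)) -> lipschitz_multi L F -> F x b ->
  exists2 b', F x' b' & enorm (b - b') <= L * enorm (x - x').
Proof.
move=> FC FL Fb; have [Fp pE] := Proj_nearest b (FC x').
exists (Proj b (F x')) => //; rewrite pE; apply: le_trans (FL x x').
rewrite /dist_H le_max; apply/orP; left.
apply: ub_le_sup; last by exists b.
have [_ cF _] := FC x; have [M _ MP] := compact_enorm_bounded (Proj b (F x')) cF.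
exists M => _ [c Fc <-]; apply: le_trans (dist_pt_le _ Fp) _.
by rewrite enormBC; exact: MP.
Qed.

End Euclid.

(** * Relaxed one-sided Lipschitz maps *)

Section ROSL.
Context {R : realType} {d : nat}.
Implicit Types (u v w x y z b : 'rV[R]_d) (A : set 'rV[R]_d) (a : R).

(** Add the two variational inequalities, each tested at a point close to the
    projection onto the other set; the result bounds the square of the
    displacement, whence projections depend on the set with Hoelder exponent 1/2. *)
Lemma Proj_perturb z z' A A' b b' h : CC A -> CC A' ->
  A b -> A' b' -> enorm (b - Proj z' A') <= h -> enorm (b' - Proj z A) <= h ->
  enorm (Proj z A - Proj z' A') ^+ 2 <=
    enorm (z - z') * enorm (Proj z A - Proj z' A')
    + h * (enorm (z - Proj z A) + enorm (z' - Proj z' A')).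
Proof.
move=> AC AC' Ab Ab' bh bh'.
have H1 := Proj_variational z AC Ab; have H2 := Proj_variational z' AC' Ab'.
move: (Proj z A) (Proj z' A') bh bh' H1 H2 => p p' bh bh' H1 H2.
have K1 : - (enorm (z - p) * h) <= edot (z - p) (b - p').
  by apply: le_trans (edot_ge _ _); rewrite lerN2 ler_wpM2l ?enorm_ge0.
have K2 : - (enorm (z' - p') * h) <= edot (z' - p') (b' - p).
  by apply: le_trans (edot_ge _ _); rewrite lerN2 ler_wpM2l ?enorm_ge0.
have K3 := edot_le (z - z') (p - p').
rewrite enorm_sqr.
have E : edot (p - p') (p - p') = edot (z - z') (p - p')
    + (edot (z - p) (b - p) - edot (z - p) (b - p'))
    + (edot (z' - p') (b' - p') - edot (z' - p') (b' - p)).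
  rewrite !edotE; ring.
rewrite E; lra.
Qed.

(** The modulus of continuity in [Proj_continuous]: [t] is the displacement of the
    projection, [s] the displacement of the argument. *)
Lemma perturb_arith (k l t s zz D D' : R) : 0 <= k -> 0 <= l -> 0 <= t -> 0 <= D ->
  0 <= s -> s <= 1 -> zz <= k * s -> D' <= zz + D + l * s ->
  t ^+ 2 <= zz * t + l * s * (D + D') ->
  t ^+ 2 <= s * (k ^+ 2 + 2 * (l * (2 * D + k + l)) + 1).
Proof.
move=> k0 l0 t0 D0 s0 s1 zk D'le H.
have h1 : zz * t <= k * s * t by rewrite ler_wpM2r.
have h2 : l * s * (D + D') <= l * s * (2 * D + k + l).
  rewrite ler_wpM2l ?mulr_ge0 //.
  have ks : k * s <= k by rewrite ler_piMr.
  have ls : l * s <= l by rewrite ler_piMr.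
  clear -D'le zk ks ls; lra.
have h3 : k * s * t <= (k * s) ^+ 2 / 2 + t ^+ 2 / 2.
  have := sqr_ge0 (k * s - t); clear; lra.
have h4 : (k * s) ^+ 2 <= s * k ^+ 2.
  by rewrite exprMn mulrC ler_wpM2r ?sqr_ge0 // expr2 ler_piMr.
clear -h1 h2 h3 h4 s0 H; lra.
Qed.

Section Field.
Variables (l L : R) (F : 'rV[R]_d -> set 'rV[R]_d).
Hypotheses (F_CC : forall z, CC (F z)) (L_ge0 : 0 <= L) (F_lip : lipschitz_multi L F).

Lemma Proj_continuous (z : 'rV[R]_d -> 'rV[R]_d) (k : R) : 0 <= k ->
  (forall x x', enorm (z x - z x') <= k * enorm (x - x')) ->
  continuous (fun x => Proj (z x) (F x)).
Proof.
move=> k0 zk; apply: continuous_of_enorm => x e e0.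
pose D := enorm (z x - Proj (z x) (F x)).
pose C := L * (2 * D + k + L).
have D0 : 0 <= D by exact: enorm_ge0.
have C0 : 0 <= C by rewrite mulr_ge0 // !addr_ge0 // mulr_ge0.
have Q0 : 0 < k ^+ 2 + 2 * C + 1 by have := sqr_ge0 k; lra.
exists (Num.min 1 (e ^+ 2 / (k ^+ 2 + 2 * C + 1))).
  by rewrite lt_min ltr01 divr_gt0 // exprn_gt0.
move=> x'; rewrite lt_min ltr_pdivlMr // => /andP[dl1 dlQ].
have [Fa _] := Proj_nearest (z x) (F_CC x).
have [Fa' aE'] := Proj_nearest (z x') (F_CC x').
have [b' Fb' bh'] := lipschitz_pointwise x' F_CC F_lip Fa.
have [b Fb bh] := lipschitz_pointwise x F_CC F_lip Fa'.
rewrite enormBC in bh; rewrite (enormBC x' x) in bh.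
rewrite enormBC in bh'.
have := Proj_perturb (F_CC x) (F_CC x') Fb Fb' bh bh'.
have D'le : enorm (z x' - Proj (z x') (F x')) <=
    enorm (z x - z x') + D + L * enorm (x - x').
  rewrite aE'; apply: le_trans (dist_pt_le _ Fb') _.
  apply: le_trans (enorm_triangle (Proj (z x) (F x)) _ _) _.
  have := enorm_triangle (z x) (z x') (Proj (z x) (F x)).
  rewrite (enormBC (z x') (z x)) -/D; move: bh'; rewrite enormBC; clear.
  by move=> h1 h2; rewrite lerD.
have zzk := zk x x'; have dl0 := enorm_ge0 (x - x').
have t0 := enorm_ge0 (Proj (z x) (F x) - Proj (z x') (F x')).
move=> H; rewrite ltNge; apply/negP => et.
suff : enorm (Proj (z x) (F x) - Proj (z x') (F x')) ^+ 2 < e ^+ 2.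
  by rewrite ltNge ler_pXn2r ?et // nnegrE ltW.
apply: le_lt_trans dlQ; rewrite /C.
apply: perturb_arith dl0 (ltW dl1) zzk D'le H.
- exact: k0.
- exact: L_ge0.
- exact: t0.
- exact: D0.
Qed.

Hypotheses (l_lt0 : l < 0) (F_ROSL : ROSL l F).

(** One step reduces the residual by the factor [L / `|2 * l|].  With [w] the
    vector from the nearest point of the new value to [ybar], [v = ybar - y] and
    [n] the claimed bound, it is enough to find [y'] in the new value with
    [edot (y' - ybar) w >= - n * enorm w].  If [edot v w <= 0], the
    Lipschitz condition alone gives it.  Otherwise the one-sided condition is used
    from [x] to a point [x''] displaced along [w], followed by the Lipschitz
    condition from [x''] to the new iterate. *)
Lemma residual_contraction x y ybar : F x y ->
  dist_pt ybar (F (x + (1 / (2 * l)) *: (ybar - y))) <=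
    L * enorm ((1 / (2 * l)) *: (ybar - y)).
Proof.
move=> Fy; set c := 1 / (2 * l); move vE : (ybar - y) => v; set x' := x + c *: v.
have lc : l * c = 1 / 2 by rewrite /c; field; rewrite lt_eqF.
have c0 : c < 0 by rewrite /c div1r invr_lt0 pmulr_rlt0.
have [Fp <-] := Proj_nearest ybar (F_CC x').
have pvar b : F x' b -> _ := @Proj_variational _ _ ybar _ b (F_CC x').
set p := Proj ybar (F x') in Fp pvar *; move wE : (ybar - p) => w.
rewrite wE in pvar.
have [w0|w0] := eqVneq (enorm w) 0.
  by rewrite w0 mulr_ge0 ?enorm_ge0.
have nw : 0 < enorm w by rewrite lt_neqAle enorm_ge0 andbT eq_sym.
set n := L * _.
suff [y' Fy' yw] : exists2 y', F x' y' & - (n * enorm w) <= edot (y' - ybar) w.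
  have := pvar _ Fy'; have -> : y' - p = (y' - ybar) + w.
    by rewrite -wE addrA subrK.
  rewrite edotDr -enorm_sqr (edotC w) expr2 => H.
  by rewrite -(ler_pM2r nw); lra.
have [vw|vw] := lerP (edot v w) 0.
  have [y' Fy' yy'] := lipschitz_pointwise x' F_CC F_lip Fy.
  exists y' => //; have -> : y' - ybar = (y' - y) - v.
    by rewrite -vE opprB addrA subrK.
  rewrite edotDl edotNl.
  have : enorm (y' - y) * enorm w <= n * enorm w.
    rewrite ler_wpM2r ?enorm_ge0 // enormBC; apply: le_trans yy' _.
    by rewrite /x' opprD addrA subrr add0r enormN.
  have := edot_ge (y' - y) w; lra.
have W0 : 0 < edot w w by rewrite -enorm_sqr exprn_gt0.
(* [s *: w - v] is the reflection of [v] in the line spanned by [w]; hence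
   [x''] is at distance [enorm (c *: v)] from [x']. *)
pose s := 2 * edot v w / edot w w.
have s0 : 0 < s by rewrite divr_gt0 // mulr_gt0.
have sW : s * edot w w = 2 * edot v w by rewrite divfK // gt_eqF.
pose x'' := x + (c * s) *: w.
have [y'' Fy'' rosl] := F_ROSL x'' Fy.
have yw : 0 <= edot (y'' - ybar) w.
  move: rosl; rewrite enorm_sqr /x'' opprD addrA subrr add0r.
  rewrite !edotNr !edotNl opprK !edotZr !edotZl => rosl.
  have cs : 0 < - (c * s) by rewrite oppr_gt0 nmulr_rlt0.
  have : edot (y - y'') w <= - edot v w.
    rewrite -(ler_pM2l cs).
    have -> : - (c * s) * - edot v w = l * (c * s * (c * s * edot w w)).
      rewrite -[c * s * edot w w]mulrA sW.
      have -> : l * (c * s * (c * (2 * edot v w))) = 2 * (l * c) * (c * s * edot v w) by ring.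
      rewrite lc; lra.
    lra.
  rewrite -vE !edotE; lra.
have [y' Fy' yy'] := lipschitz_pointwise x' F_CC F_lip Fy''.
exists y' => //; have -> : y' - ybar = (y' - y'') + (y'' - ybar).
  by rewrite addrA subrK.
rewrite edotDl.
have refl : enorm (x'' - x') = enorm (c *: v).
  have -> : x'' - x' = c *: (s *: w - v).
    by rewrite /x'' /x' opprD addrACA subrr add0r [RHS]scalerBr scalerA.
  rewrite !enormZ; congr (_ * Num.sqrt _).
  rewrite !edotE (edotC w v) sW; ring.
have : enorm (y' - y'') * enorm w <= n * enorm w.
  by rewrite ler_wpM2r ?enorm_ge0 // enormBC /n -refl.
have := edot_ge (y' - y'') w; lra.
Qed.

(** Compare the projection with a point [y] of [F x] that is in one-sided relation
    with [(x0, y0)].  In the difference of squared distances to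
    [y0 - tau^-1 *: (x - x0)], the linear term has weight [2 / tau], so [y] can be
    beaten only up to [tau / 2 * enorm (y0 - y) ^+ 2]; the Lipschitz condition and
    the boundedness of [F x0] control this error. *)
Lemma far_selection x0 y0 tau M : F x0 y0 -> 0 < tau ->
  (forall b, F x0 b -> enorm (y0 - b) <= M) ->
  forall x, edot (Proj (y0 - tau^-1 *: (x - x0)) (F x) - y0) (x - x0) <=
    l * enorm (x - x0) ^+ 2 + tau * (M ^+ 2 + L ^+ 2 * enorm (x - x0) ^+ 2).
Proof.
move=> Fy0 tau0 HM x; move uE : (x - x0) => u.
have [y Fy rosl] := F_ROSL x Fy0.
have {rosl} yu : edot (y - y0) u <= l * enorm u ^+ 2.
  by move: rosl; rewrite -[x0 - x]opprB uE -[y0 - y]opprB edotNl edotNr opprK enormN.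
have [b Fb yb] := lipschitz_pointwise x0 F_CC F_lip Fy; rewrite uE in yb.
have yM : enorm (y0 - y) <= M + L * enorm u.
  apply: le_trans (enorm_triangle b _ _) _.
  by rewrite (enormBC b y) lerD // HM.
have [_ pE] := Proj_nearest (y0 - tau^-1 *: u) (F_CC x).
have := dist_pt_le (y0 - tau^-1 *: u) Fy; rewrite -pE ler_enorm.
set f := Proj _ _.
have expand w : edot (y0 - tau^-1 *: u - w) (y0 - tau^-1 *: u - w) =
    enorm (y0 - w) ^+ 2 + 2 * tau^-1 * edot (w - y0) u + tau^-1 ^+ 2 * edot u u.
  rewrite addrAC -[w - y0]opprB; move: (y0 - w) => a.
  by rewrite enorm_sqr !edotE (edotC u a); ring.
rewrite !expand lerD2r => H.
have {}H : 2 * edot (f - y0) u <= 2 * edot (y - y0) u + tau * enorm (y0 - y) ^+ 2.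
  have f0 := sqr_ge0 (enorm (y0 - f)).
  have : 2 * tau^-1 * edot (f - y0) u <=
     2 * tau^-1 * edot (y - y0) u + enorm (y0 - y) ^+ 2 by move: H f0; clear -tau; lra.
  rewrite -(ler_pM2l tau0) mulrDr ![2 * _]mulrC -!mulrA !mulVKf ?gt_eqF //.
  by rewrite ![_ * 2]mulrC.
have : tau * enorm (y0 - y) ^+ 2 <= tau * (2 * (M ^+ 2 + L ^+ 2 * enorm u ^+ 2)).
  apply: ler_wpM2l; first exact: ltW.
  apply: (@le_trans _ _ ((M + L * enorm u) ^+ 2)).
    by rewrite ler_pXn2r ?nnegrE ?enorm_ge0 // (le_trans _ yM) ?enorm_ge0.
  have := sqr_ge0 (M - L * enorm u); lra.
lra.
Qed.

(** There are solutions arbitrarily close to the ball whose centre is the next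
    iterate and whose radius is the length of the step, from any [y0] in [F x0].
    The zero of a far selection solves the inclusion exactly, and completing the
    square in its relation with [(x0, y0)] places it in the ball up to an error
    proportional to [tau]. *)
Lemma localized_solution x0 y0 ybar eps : F x0 y0 -> 0 < eps ->
  exists2 x, F x ybar &
    enorm (x0 + (1 / (2 * l)) *: (ybar - y0) - x) ^+ 2 <=
    enorm ((1 / (2 * l)) *: (ybar - y0)) ^+ 2 + eps.
Proof.
move=> Fy0 eps0; have [_ cF0 _] := F_CC x0.
have [M M0 HM] := compact_enorm_bounded y0 cF0.
move vE : (ybar - y0) => v.
(* [B] bounds the region where the far selections may take the value [ybar];
   it serves all [tau <= 1] with [tau * L ^+ 2 <= - l / 2]. *)
pose B := 1 + 2 * (enorm v + M ^+ 2) / - l.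
have nl : 0 < - l by rewrite oppr_gt0.
have v0 : 0 <= enorm v := enorm_ge0 v.
have B1 : 1 <= B.
  rewrite lerDl; apply: divr_ge0; last exact: ltW.
  by rewrite mulr_ge0 // addr_ge0 // sqr_ge0.
pose K := M ^+ 2 + L ^+ 2 * B ^+ 2.
have K0 : 0 <= K by apply: addr_ge0; [|apply: mulr_ge0]; exact: sqr_ge0.
have L2 : 0 < 2 * (L ^+ 2 + 1) by have := sqr_ge0 L; lra.
pose tau := Num.min 1 (Num.min (- l / (2 * (L ^+ 2 + 1))) (eps * - l / (K + 1))).
have tau0 : 0 < tau.
  rewrite /tau !lt_min ltr01 (divr_gt0 nl L2) /=.
  by rewrite divr_gt0 ?mulr_gt0 // ltr_wpDl.
have tau1 : tau <= 1 by rewrite /tau ge_min lexx.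
have tauL : tau * L ^+ 2 <= - l / 2.
  have : tau <= - l / (2 * (L ^+ 2 + 1)) by rewrite /tau !ge_min lexx orbT.
  by rewrite ler_pdivlMr //; move: l_lt0 tau0; clear -l; lra.
have tauK : tau * K <= eps * - l.
  have : tau <= eps * - l / (K + 1) by rewrite /tau !ge_min lexx !orbT.
  by rewrite ler_pdivlMr; move: K0 tau0; clear -l; lra.
pose f x := Proj (y0 - tau^-1 *: (x - x0)) (F x).
have fP := far_selection Fy0 tau0 HM.
have cf : continuous f.
  apply: (@Proj_continuous _ tau^-1) => [|x x']; first by rewrite invr_ge0 ltW.
  have -> : y0 - tau^-1 *: (x - x0) - (y0 - tau^-1 *: (x' - x0)) = tau^-1 *: (x' - x).
    by rewrite opprB addrC addrA subrK -scalerBr opprB addrA subrK.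
  by rewrite enormZ enormBC ger0_norm // invr_ge0 ltW.
have bound u : B <= enorm u ->
   enorm v * enorm u + (l * enorm u ^+ 2 + tau * (M ^+ 2 + L ^+ 2 * enorm u ^+ 2)) < 0.
  move: (enorm u) => E BE.
  have E1 : 1 <= E by exact: le_trans BE.
  have lE : - l / 2 + (enorm v + M ^+ 2) <= - l / 2 * E.
    have -> : - l / 2 + (enorm v + M ^+ 2) = - l / 2 * B.
      by rewrite /B; field; rewrite lt_eqF.
    by rewrite ler_wpM2l // divr_ge0 // ltW.
  have h1 : (- l / 2 + (enorm v + M ^+ 2)) * E <= - l / 2 * E * E.
    by rewrite ler_wpM2r // (le_trans _ E1).
  have h2 : M ^+ 2 <= M ^+ 2 * E by rewrite ler_peMr ?sqr_ge0.
  have h3 : tau * M ^+ 2 <= M ^+ 2 by rewrite ler_piMl ?sqr_ge0.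
  have h4 : tau * L ^+ 2 * E ^+ 2 <= - l / 2 * E ^+ 2 by rewrite ler_wpM2r ?sqr_ge0.
  have h5 : 0 < - l * E by rewrite mulr_gt0 // (lt_le_trans _ E1).
  move: h1 h2 h3 h4 h5; move: (enorm v) => V; clear -l; lra.
have fu u : edot (f (x0 + u) - y0) u <=
    l * enorm u ^+ 2 + tau * (M ^+ 2 + L ^+ 2 * enorm u ^+ 2).
  have uE : x0 + u - x0 = u by rewrite addrC addKr.
  by have := fP (x0 + u); rewrite -/(f (x0 + u)) uE.
have [u gu] : exists u, f (x0 + u) - ybar = 0.
  apply: (@zero_of_acute _ _ _ B); first by lra.
    move=> u; apply: (@continuousB _ _ _ (fun u => f (x0 + u)) (fun=> ybar)).
      apply: (@continuous_comp _ _ _ (fun u => x0 + u) f); last exact: cf.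
      by apply: continuousD; [exact: cst_continuous|].
    exact: cst_continuous.
  move=> u /bound; apply: le_lt_trans.
  have -> : f (x0 + u) - ybar = (f (x0 + u) - y0) - v by rewrite -vE opprB addrA subrK.
  rewrite edotDl edotNl; have := fu u; have := edot_ge v u; clear -l; lra.
have fE : f (x0 + u) = ybar by apply/eqP; rewrite -subr_eq0 gu.
exists (x0 + u).
  by rewrite -fE; case: (Proj_nearest (y0 - tau^-1 *: (x0 + u - x0)) (F_CC (x0 + u))).
have := fu u; rewrite fE vE => vu.
have uB : enorm u <= B.
  rewrite leNgt; apply/negP => /ltW/bound; have := edot_ge v u.
  move: vu; clear -l; lra.
have uK : tau * (M ^+ 2 + L ^+ 2 * enorm u ^+ 2) <= eps * - l.
  apply: le_trans tauK; apply: ler_wpM2l; first exact: ltW.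
  rewrite lerD2l; apply: ler_wpM2l; first exact: sqr_ge0.
  by rewrite ler_pXn2r ?nnegrE ?enorm_ge0 // (le_trans _ B1).
rewrite opprD addrACA subrr add0r.
have -> : enorm ((1 / (2 * l)) *: v - u) ^+ 2 =
   enorm ((1 / (2 * l)) *: v) ^+ 2 + (enorm u ^+ 2 - 2 * (1 / (2 * l)) * edot v u).
  by rewrite enorm_sqr edotDl !edotDr !edotNl !edotNr -!enorm_sqr (edotC u) edotZl; ring.
rewrite lerD2l -(ler_pM2l nl).
have -> : - l * (enorm u ^+ 2 - 2 * (1 / (2 * l)) * edot v u) =
   edot v u - l * enorm u ^+ 2 by field; rewrite lt_eqF.
move: vu uK; clear -l; lra.
Qed.

End Field.
End ROSL.

(** * The iteration *)

Section Iteration.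
Context {R : realType} {d : nat}.
Variables (l L : R) (F : 'rV[R]_d -> set 'rV[R]_d) (ybar : 'rV[R]_d) (x : nat -> 'rV[R]_d).
Hypotheses (F_CC : forall z, CC (F z)) (L_ge0 : 0 <= L) (F_lip : lipschitz_multi L F).
Hypotheses (l_lt0 : l < 0) (F_ROSL : ROSL l F).

(** The solutions of [localized_solution] for every [eps] make the infimum at most
    the radius. *)
Lemma dist_solution_set x0 :
  dist_pt (x0 + (1 / (2 * l)) *: (ybar - Proj ybar (F x0))) (solution_set F ybar) <=
    `|1 / (2 * l)| * dist_pt ybar (F x0).
Proof.
have [Fy <-] := Proj_nearest ybar (F_CC x0); rewrite -enormZ.
set v := _ *: _; set D := dist_pt _ _.
have D0 : 0 <= D by exact: dist_pt_ge0.
rewrite -(@ler_pXn2r _ 2%N) ?nnegrE ?enorm_ge0 //.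
apply/ler_addgt0Pr => e e0.
have [z Sz zP] := localized_solution F_CC L_ge0 F_lip l_lt0 F_ROSL ybar Fy e0.
apply: le_trans zP; rewrite ler_pXn2r ?nnegrE ?enorm_ge0 //.
exact: dist_pt_le.
Qed.

Let q := L / `|2 * l|.
Let r n := dist_pt ybar (F (x n)).

Hypothesis L_lt : L < - (2 * l).
Hypothesis x_S : forall n, x n.+1 = x n + (1 / (2 * l)) *: (ybar - Proj ybar (F (x n))).

Let q_ge0 : 0 <= q. Proof. exact: divr_ge0. Qed.

Let normc : `|1 / (2 * l)| = `|2 * l|^-1.
Proof. by rewrite div1r normfV. Qed.

Let q_lt1 : q < 1.
Proof.
have l2 : 2 * l < 0 by rewrite pmulr_rlt0.
by rewrite /q ltr_pdivrMr ?normr_gt0 ?lt_eqF // mul1r ltr0_norm.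
Qed.

Lemma step_norm n : enorm (x n.+1 - x n) = `|2 * l|^-1 * r n.
Proof.
rewrite /r; have [_ <-] := Proj_nearest ybar (F_CC (x n)).
by rewrite x_S addrC addKr enormZ normc.
Qed.

Lemma residual_geometric n : r n <= q ^+ n * r 0%N.
Proof.
elim: n => [|n IH]; first by rewrite expr0 mul1r.
have [Fy _] := Proj_nearest ybar (F_CC (x n)).
have := residual_contraction F_CC L_ge0 F_lip l_lt0 F_ROSL ybar Fy.
rewrite -x_S -/(r n.+1) enormZ normc.
have [_ ->] := Proj_nearest ybar (F_CC (x n)); rewrite -/(r n) mulrA -/q => H.
by apply: le_trans H _; rewrite exprS -mulrA ler_wpM2l.
Qed.

Let C := `|2 * l|^-1 * r 0%N / (1 - q).

(** The bound telescopes in [k], which keeps the induction free of sums. *)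
Lemma iterates_close n k : enorm (x n - x (n + k)%N) <= C * (q ^+ n - q ^+ (n + k)).
Proof.
have q1 : 1 - q != 0 by rewrite subr_eq0 gt_eqF.
elim: k => [|k IH].
  by rewrite addn0 !subrr mulr0 /enorm /edot big1 ?sqrtr0 // => i _; rewrite mxE mul0r.
rewrite addnS; apply: le_trans (enorm_triangle (x (n + k)%N) _ _) _.
have -> : C * (q ^+ n - q ^+ (n + k).+1) =
    C * (q ^+ n - q ^+ (n + k)) + `|2 * l|^-1 * (q ^+ (n + k) * r 0%N).
  rewrite /C exprS; move: (q ^+ n) (q ^+ (n + k)) (r 0%N) (`|_|^-1) => a b s t.
  by field.
apply: lerD => //; rewrite enormBC step_norm ler_wpM2l ?invr_ge0 //.
exact: residual_geometric.
Qed.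

Let C_ge0 : 0 <= C.
Proof.
by rewrite divr_ge0 ?mulr_ge0 ?invr_ge0 ?dist_pt_ge0 // subr_ge0 ltW.
Qed.

Lemma iterates_near n m : (n <= m)%N -> enorm (x n - x m) <= C * q ^+ n.
Proof.
move=> /subnKC <-; apply: le_trans (iterates_close _ _) _.
by rewrite ler_wpM2l // gerBl exprn_ge0.
Qed.

Lemma geometric_small K e : 0 < e -> exists n, K * q ^+ n < e.
Proof.
move=> e0; have /cvgrPdist_lt /(_ e e0) [n _ /(_ n (leqnn n))] :=
  @cvg_geometric R K q (eq_rect_r (fun t => t < 1) q_lt1 (ger0_norm q_ge0)).
rewrite sub0r normrN => H; exists n; exact: le_lt_trans (ler_norm _) H.
Qed.

Lemma iterates_cvg : cvg (x n @[n --> \oo]).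
Proof.
apply: cauchy_cvg; apply: cauchy_exP => e e0.
have [n nP] := geometric_small C e0; exists (x n), n => // m /= nm.
rewrite -ball_normE /=; apply: le_lt_trans (mx_norm_le_enorm _) _.
exact: le_lt_trans (iterates_near nm) nP.
Qed.

Let xbar := lim (x n @[n --> \oo]).

Lemma limit_near n : enorm (x n - xbar) <= C * q ^+ n.
Proof.
apply/ler_addgt0Pr => e e0.
have d0 : (0 : R) < d.+1%:R by rewrite ltr0n.
have /cvgrPdist_lt /(_ _ (divr_gt0 e0 d0)) [m _ mP] := iterates_cvg.
have /= := mP _ (leq_maxr n m); rewrite ltr_pdivlMr // mulrC => h.
apply: le_trans (enorm_triangle (x (maxn n m)) _ _) _; apply: lerD.
  by apply: iterates_near; exact: leq_maxl.
rewrite enormBC; apply: le_trans (enorm_le_mx_norm _) _; exact: ltW.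
Qed.

(** The residual at the limit is at most [r n] plus the Lipschitz error
    [L * enorm (x n - xbar)], and both tend to 0. *)
Lemma limit_solution : F xbar ybar.
Proof.
have [Fp pE] := Proj_nearest ybar (F_CC xbar).
suff p0 : dist_pt ybar (F xbar) = 0.
  by move: pE Fp; rewrite p0 => /enorm_eq0/eqP; rewrite subr_eq0 => /eqP <-.
apply/eqP; rewrite eq_le dist_pt_ge0 andbT; apply/ler_addgt0Pr => e e0.
have [n nP] := geometric_small (r 0%N + L * C) e0.
have [Fy yE] := Proj_nearest ybar (F_CC (x n)).
have [b Fb yb] := lipschitz_pointwise xbar F_CC F_lip Fy.
apply: le_trans (dist_pt_le _ Fb) _.
apply: le_trans (enorm_triangle (Proj ybar (F (x n))) _ _) _; rewrite yE add0r.
apply: le_trans (ltW nP); rewrite mulrDl; apply: lerD.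
  by rewrite mulrC; exact: residual_geometric.
apply: le_trans yb _; rewrite -mulrA ler_wpM2l //; exact: limit_near.
Qed.

End Iteration.

Unset Implicit Arguments.

Theorem proposition5 (R : realType) (d : nat) (l L : R)
    (F : 'rV[R]_d -> set 'rV[R]_d) (x0 ybar : 'rV[R]_d) (x : nat -> 'rV[R]_d)
    (F_CC : forall z : 'rV[R]_d, CC (F z))
    (l_lt0 : l < 0) (F_ROSL : ROSL l F)
    (L_ge0 : 0 <= L) (F_lip : lipschitz_multi L F)
    (L_lt : L < - (2 * l))
    (x_0 : x 0%N = x0)
    (x_S : forall n : nat,
        x n.+1 = x n + (1 / (2 * l)) *: (ybar - Proj ybar (F (x n)))) :
  exists xbar : 'rV[R]_d,
    [/\ x n @[n --> \oo] --> xbar,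
        F xbar ybar,
        forall n : nat, (1 <= n)%N ->
          dist_pt (x n) (solution_set F ybar)
            <= L ^+ n.-1 / `|2 * l| ^+ n * dist_pt ybar (F x0)
      & forall n : nat, (1 <= n)%N ->
          enorm (x n - xbar)
            <= - (1 / (2 * l)) * ((L ^+ n / `|2 * l| ^+ n) / (1 - L / `|2 * l|))
               * dist_pt ybar (F x0)].
Proof.
have l2 : 2 * l < 0 by rewrite pmulr_rlt0.
exists (lim (x n @[n --> \oo])); split.
- exact: iterates_cvg F_CC L_ge0 F_lip l_lt0 F_ROSL L_lt x_S.
- exact: limit_solution F_CC L_ge0 F_lip l_lt0 F_ROSL L_lt x_S.
- case=> // k _ /=.
  rewrite x_S.
  apply: le_trans (dist_solution_set ybar F_CC L_ge0 F_lip l_lt0 F_ROSL (x k)) _.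
  have -> : L ^+ k / `|2 * l| ^+ k.+1 * dist_pt ybar (F x0) =
      `|2 * l|^-1 * ((L / `|2 * l|) ^+ k * dist_pt ybar (F x0)).
    by rewrite expr_div_n exprS invfM; ring.
  rewrite div1r normfV -x_0 ler_wpM2l ?invr_ge0 //.
  exact: residual_geometric F_CC L_ge0 F_lip l_lt0 F_ROSL x_S k.
- move=> n _; apply: le_trans (limit_near F_CC L_ge0 F_lip l_lt0 F_ROSL L_lt x_S n) _.
  have -> : - (1 / (2 * l)) = `|2 * l|^-1.
    by rewrite div1r ltr0_norm // invrN.
  rewrite x_0 -expr_div_n le_eqVlt; apply/orP; left; apply/eqP; ring.
Qed.
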